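(* Let $\mathcal{S}=\{S_1,\dots,S_m\}$ be an FI($s$)-system of contracting similarities in $\mathbb{R}^d$ which satisfies the open set condition, and let $K$ be its attractor. Then each of the numbers $$\#\pi^{-1}(x),\quad \#\pi^{-1}(\partial K_{\mathbf j}),\quad N_C(\{x\}),\quad N_C(K_{\mathbf j}),\quad \operatorname{Ord}(x,K),\quad \operatorname{Ord}(K_{\mathbf j},K)$$ has a finite upper bound which is uniform, i.e. independent of $x\in K$ and $\mathbf{j}\in I^*$.
   Context: The attractor of $\mathcal{S}$ is the unique nonempty compact $K$ with $K=\bigcup_{i=1}^m S_i(K)$. Let $I=\{1,\dots,m\}$, $I^*=\bigcup_{n\ge1}I^n$, and for $\mathbf{j}=j_1\dots j_n\in I^*$ let $S_{\mathbf j}=S_{j_1}\cdots S_{j_n}$ and $K_{\mathbf j}=S_{\mathbf j}(K)$. FI($s$)-system: the attractor $K$ is connected (a continuum), and $\#(K_i\cap K_j)\le s$ for all $i\ne j$ in $I$, where $s$ is a fixed natural number. Open set condition: there is a nonempty open set $O\subset\mathbb{R}^d$ such that the sets $S_i(O)$, $1\le i\le m$, are pairwise disjoint and contained in $O$. Index map: $\pi:I^\infty\to K$ sends an infinite sequence $\alpha=\alpha_1\alpha_2\dots$ to the unique point of $\bigcap_{n\ge1} K_{\alpha_1\dots\alpha_n}$; elements of $\pi^{-1}(x)$ are the addresses of $x$. Boundary of a piece: for $\mathbf{j}\in I^n$, $\partial K_{\mathbf j}=\bigcup_{\mathbf{i}\in I^n\setminus\{\mathbf j\}}(K_{\mathbf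 i}\cap K_{\mathbf j})$. $N_C(A)$, for $A=\{x\}$ or $A=K_{\mathbf j}$, is the supremum, over all compact connected neighborhoods $V$ of $A$ in $K$, of the number of connected components of $V\setminus A$. $\operatorname{Ord}(A,K)$ is the topological (Menger–Urysohn) order of $A$ in $K$: the least cardinal $\beta$ such that for every open $U\supset A$ in $K$ there is an open set $V$ in $K$ with $A\subset V\subset U$ whose boundary in $K$ has cardinality at most $\beta$; $\operatorname{Ord}(x,K)=\operatorname{Ord}(\{x\},K)$. *)

(* Defs.v *)
From HB Require Import structures.
From mathcomp Require Import all_boot all_order all_algebra.
From mathcomp Require Import all_classical all_reals all_analysis.

Set Implicit Arguments.
Unset Strict Implicit.
Unset Printing Implicit Defensive.

Import Order.TTheory GRing.Theory Num.Theory.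
Import numFieldNormedType.Exports.

Local Open Scope classical_set_scope.
Local Open Scope ring_scope.

(* Extended natural numbers are represented in \bar R: [counting A] is the
   number of elements of A, and is +oo when A is infinite, so that all infinite
   cardinals are identified. *)

Section Space.
Variables (R : realType) (T : topologicalType).

Definition components (A : set T) : set (set T) :=
  [set connected_component A x | x in A].

Definition component_number (A : set T) : \bar R :=
  ereal_sup [set counting (components (V `\` A)) |
             V in [set V : set T | [/\ compact V, connected V & A `<=` V°]]].

Definition boundary (V : set T) : set T := closure V `\` V°.

(* The infimum is a minimum, or +oo when no finite n is admissible. *)
Definition menger_order (A : set T) : \bar R :=
  ereal_inf [set n%:R%:E | n in [set n : nat |
    forall U : set T, open U -> A `<=` U ->
      exists V : set T, [/\ open V, A `<=` V, V `<=` U &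
                            (boundary V #<= `I_n)%card]]].

End Space.

Section Euclidean.
Variables (R : realType) (d : nat).

(* The library norm on row vectors is the sup norm; it induces the same
   topology, but not the same similarities. *)
Definition edist (x y : 'rV[R]_d) : R :=
  Num.sqrt (\sum_(i < d) (x 0 i - y 0 i) ^+ 2).

Definition contracting_similarity (f : 'rV[R]_d -> 'rV[R]_d) : Prop :=
  exists r : R, [/\ 0 < r, r < 1 &
    forall x y, edist (f x) (f y) = r * edist x y].

End Euclidean.

Section IFS.
Variables (R : realType) (d m : nat).
Implicit Types (S : 'I_m -> 'rV[R]_d -> 'rV[R]_d) (K : set 'rV[R]_d).

Definition is_attractor S K : Prop :=
  [/\ compact K, K !=set0 & K = \bigcup_(i : 'I_m) (S i @` K)].

Definition word_map S (j : seq 'I_m) : 'rV[R]_d -> 'rV[R]_d :=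
  foldr (fun i f => S i \o f) id j.

Definition piece S K (j : seq 'I_m) : set 'rV[R]_d := word_map S j @` K.

Definition FI_system (s : nat) S K : Prop :=
  connected K /\
  forall i j : 'I_m, i != j ->
    (piece S K [:: i] `&` piece S K [:: j] #<= `I_s)%card.

Definition open_set_condition S : Prop :=
  exists O : set 'rV[R]_d,
    [/\ open O, O !=set0,
        forall i : 'I_m, S i @` O `<=` O &
        forall i j : 'I_m, i != j -> S i @` O `&` S j @` O = set0].

(* When K is the attractor of contractions, the intersection is a singleton,
   and the default value 0 of xget is not used. *)
Definition coding_map S K (alpha : nat -> 'I_m) : 'rV[R]_d :=
  xget 0 (\bigcap_(n in [set n : nat | (0 < n)%N]) piece S K (mkseq alpha n)).

Definition piece_boundary S K (j : seq 'I_m) : set 'rV[R]_d :=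
  \bigcup_(i in [set i : seq 'I_m | size i = size j /\ i <> j])
    (piece S K i `&` piece S K j).

(* K_j as a subset of the space K, which carries the subspace topology. *)
Definition piece_in S K (j : seq 'I_m) : set K :=
  [set x : K | piece S K j (\val x)].

End IFS.

Arguments piece_in {R d m} S K j.

(* Main.v *)
(* The words at which the contraction ratio first drops to rho index a cover of K
   by pieces of size comparable to rho.  By the open set condition and a packing
   argument, a point, or a piece of this level, meets boundedly many of them; two
   such pieces share at most s points.  This bounds the number of addresses of a
   point, and the number of boundary points of K_j on taking rho to be the ratio
   of j.  Let A be a point or a piece K_j.  For small rho, removing from K the
   level pieces that do not meet A leaves a small open neighbourhood of A, whose
   boundary points all lie in frontiers of level pieces that contain the point A,
   or a boundary point of K_j; so the orders are bounded.  Finally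
   N_C(A) <= Ord(A, K) in any T1 space: if V is connected and G is open with n
   boundary points, then V \ G has at most n components. *)

Require Import Defs.
From HB Require Import structures.
From mathcomp Require Import all_boot all_order all_algebra.
From mathcomp Require Import all_classical all_reals all_analysis.
From mathcomp Require Import ring lra.

Set Implicit Arguments.
Unset Strict Implicit.
Unset Printing Implicit Defensive.

Import Order.TTheory GRing.Theory Num.Theory.
Import numFieldNormedType.Exports.

Local Open Scope classical_set_scope.
Local Open Scope ring_scope.

(** * Finite cardinality bounds *)

Lemma card_le_IIP T (A : set T) n :
  (A #<= `I_n)%card <->
  exists2 f : T -> nat, (forall x, A x -> (f x < n)%N) & set_inj A f.
Proof.
split=> [/pcard_leP/injfunPex[f]|[f fn finj]]; first by exists f.
by apply/pcard_leP/injfunPex; exists f.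
Qed.

(** A point is coded by the number of a chosen index [c x] and by its own number within [F (c x)];
    division by [k] recovers both. *)
Lemma card_bigcup_le I T (B : set I) (F : I -> set T) n k :
  (B #<= `I_n)%card -> (forall i, B i -> (F i #<= `I_k)%card) ->
  (\bigcup_(i in B) F i #<= `I_(n * k))%card.
Proof.
move=> /card_le_IIP[g gn ginj] Fk.
have /choice[h hP] i : exists h : T -> nat,
    B i -> (forall x, F i x -> (h x < k)%N) /\ set_inj (F i) h.
  have [Bi|nBi] := pselect (B i); last by exists (fun=> 0%N).
  by have /card_le_IIP[h hk hinj] := Fk i Bi; exists h.
have [[i0 Bi0]|B0] := pselect (B !=set0); last first.
  suff -> : B = set0 by rewrite bigcup_set0 card_ge0.
  by apply/eqP/negPn/negP => /set0P.
have /choice[c cP] x : exists i, (\bigcup_(i in B) F i) x -> B i /\ F i x.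
  have [[i Bi Fi]|nx] := pselect ((\bigcup_(i in B) F i) x); first by exists i.
  by exists i0.
apply/card_le_IIP; exists (fun x => (g (c x) * k + h (c x) x)%N) => [x Ux|x y].
  have [Bc Fc] := cP x Ux; have [/(_ _ Fc) hk _] := hP _ Bc.
  rewrite (@leq_trans ((g (c x)).+1 * k))//; last by rewrite leq_mul2r gn ?orbT.
  by rewrite mulSn addnC ltn_add2r.
move=> /set_mem Ux /set_mem Uy.
have [Bx Fx] := cP x Ux; have [By Fy] := cP y Uy.
have [hx inj] := hP _ Bx; have [hy _] := hP _ By.
have k0 : (0 < k)%N by apply: leq_ltn_trans (hx _ Fx).
move=> /[dup]/(congr1 (fun u => u %/ k)%N) + /(congr1 (fun u => u %% k)%N).
rewrite !divnMDl// !(divn_small (hx _ Fx)) !(divn_small (hy _ Fy)) !addn0.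
move=> /(ginj _ _ (mem_set Bx) (mem_set By)) exy.
rewrite !modnMDl !modn_small ?hx ?hy// -exy.
by apply: inj; rewrite inE// exy.
Qed.

Lemma card_le_pigeonhole T (A : set T) n (f : 'I_n.+1 -> T) :
  (A #<= `I_n)%card -> (forall i, A (f i)) -> injective f -> False.
Proof.
move=> /card_le_IIP[g gn ginj] Af finj.
have gf_inj : injective (fun i => Ordinal (gn _ (Af i))).
  by move=> i j [] /ginj; rewrite !inE => /(_ (Af i) (Af j)); exact: finj.
by have := leq_card _ gf_inj; rewrite !card_ord ltnn.
Qed.

Lemma not_card_leP T (A : set T) n : ~ (A #<= `I_n)%card ->
  exists2 f : 'I_n.+1 -> T, (forall i, A (f i)) & injective f.
Proof.
move=> nA; have : (`I_n.+1 #<= A)%card.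
  have [/finite_setP[k Ak]|/infiniteP infA] := pselect (finite_set A); last first.
    by apply: card_le_trans infA; exact: subset_card_le.
  rewrite (card_le_eqr Ak) card_le_II ltnNge; apply/negP => kn.
  by apply: nA; rewrite (card_le_eql Ak) card_le_II.
move=> /card_leP[f].
have In (i : 'I_n.+1) : val i \in `I_n.+1 by rewrite inE/=.
exists (fun i => set_val (f (exist _ (val i) (In i)))) => [i|i j]; first exact: set_valP.
move=> /val_inj; move=> /('inj_f); rewrite !inE => /(_ I I) /(congr1 val) /= ij.
exact: val_inj.
Qed.

Lemma counting_le (R : realType) (T : choiceType) (A : set T) n :
  (A #<= `I_n)%card -> (counting A <= n%:R%:E :> \bar R)%E.
Proof.
move=> An; have finA : finite_set A by apply/finite_set_leP; exists n.
by rewrite /counting asboolT// lee_fin ler_nat geq_card_fset_set.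
Qed.

Lemma card_le_image_inj T U (f : T -> U) (A : set T) n :
  injective f -> (f @` A #<= `I_n)%card -> (A #<= `I_n)%card.
Proof.
move=> finj /card_le_IIP[g gn ginj]; apply/card_le_IIP; exists (g \o f).
  by move=> x Ax; apply: gn; exists x.
move=> x y /set_mem Ax /set_mem Ay gfxy; apply/finj/ginj => //; rewrite inE.
  by exists x.
by exists y.
Qed.

(** * Components of the complement and order *)

Section Splitting.
Variable T : topologicalType.
Implicit Types A B C E V W : set T.

Lemma separatedS A B A' B' : A' `<=` A -> B' `<=` B ->
  separated A B -> separated A' B'.
Proof.
move=> AA BB [h1 h2]; split; rewrite -subset0.
  by rewrite -h1; apply: setISS => //; exact: closureS.
by rewrite -h2; apply: setISS => //; exact: closureS.
Qed.

Lemma separatedUr A B C : separated A B -> separated A C -> separated A (B `|` C).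
Proof.
by move=> [h1 h2] [h3 h4]; split; rewrite ?closureU setIUr ?h1 ?h2 ?h3 ?h4 setU0.
Qed.

(** Starting from [W] as a single part, a disconnected part is split in two until all parts are
    connected or there are [n + 1] of them. *)
Lemma connected_parts W n :
  (exists2 f : 'I_n -> set T,
     forall i, connected (f i) /\ f i `<=` W & W `<=` \bigcup_i f i) \/
  (exists f : 'I_n.+1 -> set T, [/\ W `<=` \bigcup_i f i,
     forall i, f i !=set0 /\ f i `<=` W,
     forall i, separated (f i) (W `\` f i) &
     forall i j x, f i x -> f j x -> i = j]).
Proof.
elim: n => [|n [[f fW Wf]|[f [Wf fW sepf disf]]]].
- have [->|/set0P W0] := eqVneq W set0.
    by left; exists (fun=> set0) => // -[].
  right; exists (fun=> W); split=> [x Wx|i|i|i j x _ _].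
  + by exists ord0.
  + by split.
  + by rewrite setDv; split; rewrite ?closure0 ?setI0 ?set0I.
  + by rewrite (ord1 i) (ord1 j).
(* The empty set fills the extra index. *)
- left; exists (fun i => if unlift ord0 i is Some k then f k else set0).
    by move=> i; case: unliftP => [k _|_]; [exact: fW|split => //; exact: connected0].
  by move=> x /Wf[k _ fkx]; exists (lift ord0 k) => //; rewrite liftK.
- have [fC|/existsNP[i /connectedPn[E [E0 fiE sepE]]]] :=
    pselect (forall i, connected (f i)).
    by left; exists f => // i; split => //; case: (fW i).
  have Efi b : E b `<=` f i by rewrite fiE; case: b; [exact: subsetUr|exact: subsetUl].
  have [_ fiW] := fW i.
  (* Off [E b], [W] consists of the other half of [f i] and of points outside [f i]; both are
     separated from [E b]. *)
  have sepEW b : separated (E b) (W `\` E b).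
    apply: (@separatedS (E b) (E (~~ b) `|` (W `\` f i))) => //.
      move=> x [Wx nEx]; have [fix_|nf] := pselect (f i x); last by right.
      by left; move: fix_; rewrite fiE => -[]; case: b nEx.
    apply: separatedUr; first by case: b; rewrite //= separatedC.
    by apply: separatedS (sepf i).
  right; exists (fun k => if unlift ord0 k is Some k'
    then if k' == i then E true else f k' else E false); split.
  + move=> x /Wf[k _]; have [->|ki] := eqVneq k i; last first.
      by move=> fkx; exists (lift ord0 k) => //; rewrite liftK (negbTE ki).
    rewrite fiE => -[] Ex; first by exists ord0 => //; rewrite unlift_none.
    by exists (lift ord0 i) => //; rewrite liftK eqxx.
  + move=> k; case: unliftP => [k' _|_]; last by split => //; exact: subset_trans fiW.
    by case: eqP => _ //; split => //; exact: subset_trans fiW.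
  + move=> k; case: unliftP => [k' _|_]; last exact: sepEW.
    by case: eqP => _; [exact: sepEW|exact: sepf].
  + have EE x : E true x -> E false x -> False.
      by move=> Et Ef; have := separated_disjoint sepE; apply/eqP/set0P; exists x.
    move=> k l x; case: unliftP => [k' ->|->]; case: unliftP => [l' ->|->] //.
    * case: eqP => [->|k'i]; case: eqP => [->|l'i] //.
      - by move=> /Efi fix_ /(disf _ _ _ fix_) ->.
      - by move=> /[swap] /Efi fix_ /(disf _ _ _ fix_) ->.
      - by move=> fk /(disf _ _ _ fk) ->.
    * case: eqP => [_ Et Ef|k'i fk /Efi /(disf _ _ _ fk)//].
      by case: (EE _ Et Ef).
    * case: eqP => [_ Ef Et|k'i /Efi /[swap] fk /(disf _ _ _ fk)//].
      by case: (EE _ Et Ef).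
Qed.

(** If [E] missed the boundary of [G], it would also be separated from the part of [V] inside [G],
    and [V] would be disconnected. *)
Lemma relatively_clopen_meets_boundary V G E : connected V -> open G ->
    V `&` G !=set0 -> E !=set0 -> E `<=` V `\` G ->
  separated E ((V `\` G) `\` E) -> E `&` boundary G !=set0.
Proof.
move=> Vconn oG [a [Va Ga]] [e Ee] EW sepE; apply: contrapT => EF.
have sepEG : separated E (V `&` G).
  split; apply/eqP/negPn/negP => /set0P[x].
    have : closure E `<=` ~` G.
      rewrite [X in _ `<=` X](closure_id (~` G)).1; last exact: open_closedC.
      by apply: closureS => y /EW[].
    by move=> + [cE [_ Gx]] => /(_ _ cE).
  move=> [Ex /(closureS (@subIsetr _ V G)) cGx]; apply: EF; exists x; split => //.
  by split=> // /interior_subset; have [] := EW _ Ex.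
have VU : V `<=` E `|` (((V `\` G) `\` E) `|` (V `&` G)).
  move=> x Vx; have [Ex|nEx] := pselect (E x); first by left.
  by right; have [Gx|nGx] := pselect (G x); [right|left].
have [VE|VE] := connected_subset (separatedUr sepE sepEG) VU Vconn.
  by have [] := EW _ (VE _ Va).
by have [[_]|[_]] := VE _ (EW _ Ee).1 => //; have [] := EW _ Ee.
Qed.

End Splitting.

(* [G] is chosen to avoid one point of each of [n + 1] supposed components of
   [V `\` A]; if [V `\` G] split into [n + 1] relatively clopen parts, each of
   them would contain a boundary point of [G]. *)
Lemma component_number_le (R : realType) (T : topologicalType) (A : set T) n :
  accessible_space T -> A !=set0 ->
  (forall U, open U -> A `<=` U -> exists V, [/\ open V, A `<=` V, V `<=` U &
     (boundary V #<= `I_n)%card]) ->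
  (component_number R A <= n%:R%:E)%E.
Proof.
move=> T1 [a Aa] AV; apply: ub_ereal_sup => _ [V [_ Vconn AVint] <-].
apply: counting_le; apply: contrapT => /not_card_leP[f fcomp finj].
have /choice[y yP] i : exists y, (V `\` A) y /\ connected_component (V `\` A) y = f i.
  by have [y VAy <-] := fcomp i; exists y.
have [G [oG AG GU Gn]] : exists G, [/\ open G, A `<=` G, G `<=` ~` range y &
    (boundary G #<= `I_n)%card].
  apply: AV; last by move=> x Ax [i _ yx]; have [[_]] := yP i; rewrite yx.
  apply: closed_openC; apply: (accessible_finite_set_closed.1 T1); exact: finite_image.
have Va : V a by apply: interior_subset; exact: AVint.
have [[g gP Wg]|[g [_ gP sepg disg]]] := connected_parts (V `\` G) n.
  (* Since [A] lies in [G], a connected part outside [G] stays within one component off [A], so no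
     part contains two of the [y i]. *)
  have /choice[k kP] i : exists k, g k (y i).
    have [|k _ gky] := Wg (y i); last by exists k.
    by split; [have [[]] := yP i|move=> /GU; apply; exists i].
  have kinj : injective k.
    move=> i j kij; apply: finj.
    have [_ <-] := yP i; have [_ <-] := yP j.
    apply: same_connected_component.
    exists (g (k i)); last by rewrite kij.
    have [gconn gW] := gP (k i); split => //.
    by move=> x /gW[Vx nGx]; split => // /AG.
  by have := leq_card _ kinj; rewrite !card_ord ltnn.
have /choice[b bP] i : exists b, g i b /\ boundary G b.
  have [gi0 giW] := gP i.
  have [|b [gb Gb]] := relatively_clopen_meets_boundary Vconn oG _ gi0 giW (sepg i).
    by exists a; split => //; exact: AG.
  by exists b.
apply: (card_le_pigeonhole Gn (fun i => (bP i).2)) => i j bij.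
by apply: (disg i j (b i)); [have [] := bP i|rewrite bij; have [] := bP j].
Qed.

(** * Similarities of Euclidean space *)

(* [all_analysis] has another [edist]. *)
Local Notation edist := Defs.edist.

Section EuclideanDistance.
Variables (R : realType) (d : nat).
Implicit Types x y : 'rV[R]_d.

Lemma edist_sqr x y : edist x y ^+ 2 = \sum_(i < d) (x 0 i - y 0 i) ^+ 2.
Proof. by rewrite sqr_sqrtr// sumr_ge0// => i _; exact: sqr_ge0. Qed.

Lemma edist_ge0 x y : 0 <= edist x y.
Proof. exact: sqrtr_ge0. Qed.

Lemma edistC x y : edist x y = edist y x.
Proof. by congr Num.sqrt; apply: eq_bigr => i _; rewrite -sqrrN opprB. Qed.

Lemma normr_le_edist x y : `|x - y| <= edist x y.
Proof.
rewrite [leLHS]/Num.Def.normr/= mx_normrE; apply: bigmax_le; first exact: edist_ge0.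
move=> [i j] _ /=; rewrite ord1 !mxE.
rewrite -ler_sqr ?nnegrE ?normr_ge0 ?edist_ge0//.
rewrite edist_sqr real_normK ?num_real// (bigD1 j)//= lerDl.
by rewrite sumr_ge0// => k _; exact: sqr_ge0.
Qed.

Lemma coord_le_normr x (i : 'I_d) : `|x 0 i| <= `|x|.
Proof.
rewrite [leRHS]/Num.Def.normr/= mx_normrE.
exact: (@le_bigmax _ _ _ _ (fun ij : 'I_1 * 'I_d => `|x ij.1 ij.2|) (0, i)).
Qed.

Lemma edist_le_coord x y (e : R) : 0 <= e ->
  (forall i, `|x 0 i - y 0 i| <= e) -> edist x y <= d%:R * e.
Proof.
move=> e0 xye; rewrite -ler_sqr ?nnegrE ?edist_ge0 ?mulr_ge0//.
rewrite edist_sqr (@le_trans _ _ (\sum_(i < d) e ^+ 2))//.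
  apply: ler_sum => i _.
  by rewrite -(@real_normK _ (_ - _)) ?num_real// ler_sqr ?nnegrE ?normr_ge0.
rewrite sumr_const card_ord -[leLHS]mulr_natl exprMn ler_wpM2r ?sqr_ge0//.
by rewrite -natrX ler_nat; case: d => // k; rewrite leq_pmulr.
Qed.

Lemma edist_le_normr x y : edist x y <= d%:R * `|x - y|.
Proof.
apply: edist_le_coord => // i.
by rewrite (le_trans _ (coord_le_normr _ i))// !mxE.
Qed.

Lemma edist_eq0 x y : edist x y = 0 -> x = y.
Proof.
move=> xy0; apply/eqP; rewrite -subr_eq0 -normr_eq0 eq_le normr_ge0 andbT.
by rewrite -xy0 normr_le_edist.
Qed.

(* After subtracting [f 0] and dividing by [r], [f] preserves inner products, so
   the images of the standard basis are the rows of an orthogonal matrix; a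
   vector is determined by its inner products with them. *)
Lemma similarity_surj (f : 'rV[R]_d -> 'rV[R]_d) (r : R) : 0 < r ->
  (forall x y, edist (f x) (f y) = r * edist x y) -> forall y, exists x, f x = y.
Proof.
move=> r0 fr y.
have rn0 : r != 0 by rewrite gt_eqF.
pose dot (u v : 'rV[R]_d) := \sum_(i < d) u 0 i * v 0 i.
pose g x := r^-1 *: (f x - f 0).
(* Polarization: lengths and distances determine inner products. *)
have dotB u v : dot u v = (dot u u + dot v v - \sum_(i < d) (u 0 i - v 0 i) ^+ 2) / 2.
  apply: (@mulIf _ 2) => //; rewrite mulfVK// mulr_suml -big_split/= -sumrB.
  by apply: eq_bigr => i _; ring.
have gdist u v : \sum_(i < d) (g u 0 i - g v 0 i) ^+ 2 = \sum_(i < d) (u 0 i - v 0 i) ^+ 2.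
  rewrite -[RHS]edist_sqr.
  have -> : edist u v = r^-1 * edist (f u) (f v) by rewrite fr mulKf.
  rewrite exprMn edist_sqr mulr_sumr; apply: eq_bigr => i _.
  by rewrite !mxE; ring.
have g0 : g 0 = 0 by rewrite /g subrr scaler0.
have gg u : dot (g u) (g u) = dot u u.
  have sub0 (w : 'rV[R]_d) : \sum_(i < d) (w 0 i - (0 : 'rV[R]_d) 0 i) ^+ 2 = dot w w.
    by apply: eq_bigr => i _; rewrite [(0 : 'rV[R]_d) _ _]mxE subr0.
  by have := gdist u 0; rewrite g0 !sub0.
have gdot u v : dot (g u) (g v) = dot u v by rewrite dotB !gg gdist -dotB.
pose A : 'M[R]_d := \matrix_(i, j) g (delta_mx 0 i) 0 j.
have AA : A *m A^T = 1%:M.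
  apply/matrixP => i j; rewrite !mxE.
  transitivity (dot (g (delta_mx 0 i)) (g (delta_mx 0 j))).
    by apply: eq_bigr => k _; rewrite !mxE.
  rewrite gdot /dot (bigD1 i)//= big1 ?addr0 => [|k ki]; rewrite !mxE !eqxx/=.
    by rewrite mul1r.
  by rewrite (negbTE ki) mul0r.
have dotA u i : (u *m A^T) 0 i = dot u (g (delta_mx 0 i)).
  by rewrite mxE; apply: eq_bigr => k _; rewrite !mxE.
pose z := r^-1 *: (y - f 0).
exists (z *m A^T); apply: (@addIr _ (- f 0)).
have : g (z *m A^T) *m A^T = z *m A^T.
  apply/rowP => i; rewrite dotA gdot /dot (bigD1 i)//= big1 ?addr0.
    by rewrite [delta_mx _ _ _ _]mxE !eqxx mulr1.
  by move=> k ki; rewrite [delta_mx _ _ _ _]mxE (negbTE ki) andbF mulr0.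
move=> /(congr1 (mulmx^~ A)); rewrite -!mulmxA (mulmx1C AA) !mulmx1 /g /z.
by move=> /(congr1 (fun u => r *: u)); rewrite !scalerA divff// !scale1r.
Qed.

End EuclideanDistance.

Lemma exists_pos_lbound (R : realType) m (f : 'I_m -> R) : (forall i, 0 < f i) ->
  exists e, [/\ 0 < e, e < 1 & forall i, e <= f i].
Proof.
(* The seed 1/2 keeps the minimum below 1 and covers [m = 0]. *)
move=> f0; exists (\big[Order.min/2^-1]_i f i); split=> [||i].
- by apply: lt_bigmin => //; rewrite invr_gt0.
- by apply: le_lt_trans (bigmin_le_id _ _ _ _) _; rewrite invf_lt1// ltr1n.
- exact: bigmin_le.
Qed.

(** The words branch after a longest common prefix [u]; the FI and open set conditions apply to the
    letters [a] and [b] at the branching. *)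
Lemma not_prefixP (T : eqType) (w v : seq T) : ~~ prefix w v -> ~~ prefix v w ->
  exists u a b w' v', [/\ a != b, w = u ++ a :: w' & v = u ++ b :: v'].
Proof.
elim: w v => [|a w IH] [|b v] //=; have [->|ab] := eqVneq a b; last first.
  by move=> _ _; exists [::], a, b, w, v.
move=> /= wv vw; have [u [a' [b' [w' [v' [ab -> ->]]]]]] := IH _ wv vw.
by exists (b :: u), a', b', w', v'.
Qed.

(* The grid cells of side [c * rho / (d + 1)] each contain at most one point. *)
Lemma card_le_separated (R : realType) d T (f : T -> 'rV[R]_d) (c D : R) : 0 < c ->
  exists N, forall (A : set T) (rho : R) (p : 'rV[R]_d), 0 < rho ->
    (forall w i, A w -> `|f w 0 i - p 0 i| <= D * rho) ->
    (forall w v, A w -> A v -> w <> v -> c * rho <= edist (f w) (f v)) ->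
    (A #<= `I_N)%card.
Proof.
(* Dividing by [d + 1] makes [d * eta * rho], which bounds the distance of two points in a cell,
   strictly less than [c * rho]. *)
move=> c0; pose eta := c / d.+1%:R; have eta0 : 0 < eta by rewrite divr_gt0.
pose M := Num.truncn (2 * D / eta).
exists #|{ffun 'I_d -> 'I_M.+1}| => A rho p rho0 Ap Asep.
have er0 : 0 < eta * rho by rewrite mulr_gt0.
pose t w i := (f w 0 i - p 0 i + D * rho) / (eta * rho).
have t_ge0 w i : A w -> 0 <= t w i.
  move=> Aw; have := Ap w i Aw; rewrite ler_norml => /andP[h _].
  by rewrite divr_ge0 ?(ltW er0)//; lra.
have t_le w i : A w -> t w i <= 2 * D / eta.
  move=> Aw; have := Ap w i Aw; rewrite ler_norml => /andP[_ h].
  rewrite ler_pdivrMr// mulrA divfK ?gt_eqF//; lra.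
apply/card_le_IIP.
pose cell w : {ffun 'I_d -> 'I_M.+1} := [ffun i => inord (Num.truncn (t w i))].
exists (fun w => val (enum_rank (cell w))) => [w Aw|w v].
  exact: ltn_ord.
move=> /set_mem Aw /set_mem Av /val_inj /enum_rank_inj /ffunP cellE.
apply: contrapT => wv; have := Asep w v Aw Av wv; apply/negP; rewrite -ltNge.
have close i : `|f w 0 i - f v 0 i| <= eta * rho.
  have := cellE i; rewrite !ffunE => /(congr1 val).
  rewrite /= !inordK ?ltnS ?le_truncn ?t_le//.
  move=> tE; have /andP[w1 w2] := truncn_itv (t_ge0 w i Aw).
  have /andP[v1 v2] := truncn_itv (t_ge0 v i Av).
  have -> : f w 0 i - f v 0 i = (t w i - t v i) * (eta * rho).
    by rewrite /t -mulrBl divfK ?gt_eqF//; ring.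
  rewrite normrM (gtr0_norm er0) ler_piMl ?(ltW er0)// ler_norml.
  by rewrite tE -natr1 in w1 w2; rewrite -natr1 in v2; apply/andP; split; lra.
apply: le_lt_trans (edist_le_coord (ltW er0) close) _.
rewrite mulrA ltr_pM2r// /eta mulrCA -[ltRHS]mulr1 ltr_pM2l//.
by rewrite ltr_pdivrMr// mul1r ltr_nat.
Qed.

(** Half the radius of a ball around [a] inside [U] serves all points near [a]; compactness then
    gives one [e] for the whole of [A]. *)
Lemma compact_open_collar (R : realType) (V : normedModType R) (A U : set V) :
  compact A -> open U -> A `<=` U ->
  exists2 e, 0 < e & forall a x, A a -> `|a - x| < e -> U x.
Proof.
move=> Acomp oU AU.
have Anear : \forall e \near (0 : R)^'+,
    A `<=` [set a | forall x, `|a - x| < e -> U x].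
  apply: (compact_near_coveringP A).1 => // a /AU Ua.
  have /nbhs_ballP[e /= e0 eU] : nbhs a U by exact: open_nbhs_nbhs.
  have e2 : 0 < e / 2 by exact: divr_gt0.
  near=> b t.
  have ab : `|a - b| < e / 2 by near: b; exact: cvgr_dist_lt.
  have te : t < e / 2 by near: t; exact: nbhs_right_lt.
  move=> x bx; apply: eU; rewrite -ball_normE /ball_/= -(subrK b a) -addrA.
  apply: le_lt_trans (ler_normD _ _) _; rewrite (splitr e) ltrD//.
  exact: lt_trans bx te.
have [e [e0 eA]] := filter_ex (filterI (nbhs_right_gt (0 : R)) Anear).
by exists e => // a x /eA; exact.
Unshelve. all: by end_near. Qed.

(** * Pieces of comparable size *)

Section IteratedFunctionSystem.
Variables (R : realType) (d m s : nat) (S : 'I_m -> 'rV[R]_d -> 'rV[R]_d).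
Variables (K : set 'rV[R]_d) (r : 'I_m -> R).
Hypothesis r_gt0 : forall i, 0 < r i.
Hypothesis r_lt1 : forall i, r i < 1.
Hypothesis S_sim : forall i x y, edist (S i x) (S i y) = r i * edist x y.
Hypothesis attrK : is_attractor S K.
Hypothesis FI : FI_system s S K.
Hypothesis OSC : open_set_condition S.
Implicit Types (u v w : seq 'I_m) (x y p : 'rV[R]_d) (rho : R).

Local Notation Sw := (word_map S).
Local Notation Kw := (piece S K).
Definition word_ratio w := \prod_(i <- w) r i.

Lemma word_ratio_gt0 w : 0 < word_ratio w.
Proof. exact: prodr_gt0. Qed.

Lemma word_ratio_cat u v : word_ratio (u ++ v) = word_ratio u * word_ratio v.
Proof. exact: big_cat. Qed.

Lemma word_ratio_le1 w : word_ratio w <= 1.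
Proof. by apply: prodr_ile1 => i _; rewrite !ltW. Qed.

Lemma word_ratio_lt1 w : w != [::] -> word_ratio w < 1.
Proof.
case: w => // i w _; rewrite /word_ratio big_cons.
by apply: le_lt_trans (r_lt1 i); rewrite ler_piMr ?word_ratio_le1// ltW.
Qed.

Lemma word_ratio_prefix_lt u w : prefix u w -> u != w -> word_ratio w < word_ratio u.
Proof.
move=> /prefixP[v ->] uv; rewrite word_ratio_cat gtr_pMr ?word_ratio_gt0//.
by apply: word_ratio_lt1; apply: contra_neq uv => ->; rewrite cats0.
Qed.

Lemma word_ratio_prefix_le u w : prefix u w -> word_ratio w <= word_ratio u.
Proof.
by move=> /prefixP[v ->]; rewrite word_ratio_cat ger_pMr ?word_ratio_gt0 ?word_ratio_le1.
Qed.

Lemma word_map_cat u v x : Sw (u ++ v) x = Sw u (Sw v x).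
Proof. by elim: u => //= i u ->. Qed.

Lemma edist_word_map w x y : edist (Sw w x) (Sw w y) = word_ratio w * edist x y.
Proof.
elim: w => [|i w IH] /=; first by rewrite /word_ratio big_nil mul1r.
by rewrite S_sim IH mulrA /word_ratio big_cons.
Qed.

Lemma word_map_inj w : injective (Sw w).
Proof.
move=> x y Sxy; apply: edist_eq0; apply: (mulfI (lt0r_neq0 (word_ratio_gt0 w))).
rewrite -edist_word_map Sxy mulr0; apply/eqP.
by rewrite sqrtr_eq0 big1// => i _; rewrite subrr expr0n.
Qed.

Lemma word_map_surj w y : exists x, Sw w x = y.
Proof. exact: similarity_surj (word_ratio_gt0 w) (edist_word_map w) y. Qed.

(** Applied to [K] and to the open set of the open set condition. *)
Lemma word_map_invariant (X : set 'rV[R]_d) w :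
  (forall i, S i @` X `<=` X) -> Sw w @` X `<=` X.
Proof.
move=> SX _ [x Xx <-]; elim: w => [//|i w IH] /=.
by apply: (SX i); exists (Sw w x).
Qed.

Lemma piece_sub w : Kw w `<=` K.
Proof.
apply: word_map_invariant => i; have [_ _ {2}->] := attrK.
by move=> x SKx; exists i.
Qed.

Lemma piece_cat_sub u v : Kw (u ++ v) `<=` Kw u.
Proof.
move=> _ [x Kx <-]; rewrite word_map_cat; exists (Sw v x) => //.
by apply: (@piece_sub v); exists x.
Qed.

Lemma piece_prefix_sub u w : prefix u w -> Kw w `<=` Kw u.
Proof. by move=> /prefixP[v ->]; exact: piece_cat_sub. Qed.

(** Each use of the attractor equation appends one letter. *)
Lemma piece_extend u x n : Kw u x -> exists2 v, size v = n & Kw (u ++ v) x.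
Proof.
elim: n x => [|n IH] x ux; first by exists [::]; rewrite ?cats0.
have [v vn [y Ky <-]] := IH x ux; have := Ky; have [_ _ {1}->] := attrK.
move=> [i _ [z Kz <-]]; exists (rcons v i); first by rewrite size_rcons vn.
by rewrite -cats1 catA; exists z => //; rewrite word_map_cat.
Qed.

(* The words at which the ratio first drops to [rho] or below. *)
Definition level rho w :=
  word_ratio w <= rho /\ forall v, prefix v w -> v != w -> rho < word_ratio v.

(** Ratios strictly decrease along prefixes; hence every piece can be treated as a piece of some
    level. *)
Lemma level_word_ratio w : level (word_ratio w) w.
Proof. by split=> // v; exact: word_ratio_prefix_lt. Qed.

Lemma level_prefix rho w v : level rho w -> level rho v -> prefix w v -> w = v.
Proof.
move=> [wrho _] [_ vP] wv; apply/eqP; apply: contraT => nwv.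
by have := vP w wv nwv; rewrite ltNge wrho.
Qed.

Lemma level_not_prefix rho w v : level rho w -> level rho v -> w <> v ->
  ~~ prefix w v && ~~ prefix v w.
Proof.
move=> lw lv wv; apply/andP; split; apply/negP => /level_prefix pr; apply: wv.
  exact: (pr rho).
by rewrite (pr rho).
Qed.

(** All ratios are at most [1 - q] for one [q > 0], so word ratios decay geometrically in the
    length. *)
Lemma small_word_ratio rho : 0 < rho ->
  exists n, forall w, (n <= size w)%N -> word_ratio w <= rho.
Proof.
move=> rho0.
have [|q [q0 q1 qr]] := @exists_pos_lbound R m (fun i => 1 - r i).
  by move=> i; rewrite subr_gt0.
have q1_ge0 : 0 <= 1 - q by rewrite subr_ge0 ltW.
have /(_ _)/cvgrPdist_lt/(_ _ rho0)[|n _ nP] := @cvg_geometric R 1 (1 - q).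
  by rewrite ger0_norm// ltrBlDr ltrDl.
exists n => w wn; have wq : word_ratio w <= (1 - q) ^+ size w.
  rewrite /word_ratio; elim: w {wn} => [|i w IH]; first by rewrite big_nil.
  rewrite big_cons exprS ler_pM ?(ltW (r_gt0 _)) ?(ltW (word_ratio_gt0 _))//.
  by rewrite lerBrDr addrC -lerBrDr.
apply: (le_trans wq); have := nP _ wn.
by rewrite /= sub0r normrN mul1r ger0_norm ?exprn_ge0// => /ltW.
Qed.

(** The word [u] is extended through [x] until the ratio is small, then cut where the ratio first
    drops to [rho]. The cut word and [u] are prefixes of one word, hence comparable. *)
Lemma level_through rho u x : 0 < rho -> Kw u x ->
  exists w, [/\ level rho w, Kw w x & prefix w u || prefix u w].
Proof.
move=> rho0 ux; have [n nP] := small_word_ratio rho0.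
have [v vn uvx] := piece_extend n ux.
have uvrho : exists k, word_ratio (take k (u ++ v)) <= rho.
  by exists (size (u ++ v)); rewrite take_size nP// size_cat vn leq_addl.
case: (ex_minnP uvrho) => k krho kmin.
exists (take k (u ++ v)); split.
- split=> // t tw tnw; rewrite ltNge; apply/negP => trho.
  have tuv : prefix t (u ++ v) by apply: prefix_trans tw (prefix_take _ _).
  have /eqP et : take (size t) (u ++ v) == t by rewrite -prefixE.
  have kt : (k <= size t)%N by apply: kmin; rewrite et.
  move: tnw; rewrite -et => /eqP; apply.
  have := size_prefix tw; rewrite size_take => tk.
  have tk' : (size t <= k)%N by apply: leq_trans tk _; case: ltnP.
  by congr take; apply/eqP; rewrite eqn_leq tk' kt.
- by apply: (piece_prefix_sub (prefix_take _ k)).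
- rewrite take_cat; case: ltnP => _; first by rewrite prefix_take.
  by rewrite [prefix u _]prefix_prefix orbT.
Qed.

(** * Overlaps and packing of level pieces *)

(** The intersection lies in the image under [Sw u] of the intersection of two first-level pieces,
    [u] being the common prefix. *)
Lemma card_piece_intersection w v : ~~ prefix w v && ~~ prefix v w ->
  (Kw w `&` Kw v #<= `I_s)%card.
Proof.
move=> /andP[/not_prefixP /[apply]] [u [a [b [w' [v' [ab -> ->]]]]]].
have [_ /(_ a b ab) abs] := FI.
apply: card_le_trans abs.
apply: card_le_trans (card_image_le (Sw u) (Kw [:: a] `&` Kw [:: b])).
apply: subset_card_le => x [].
rewrite -[a :: w']cat1s -[b :: v']cat1s !catA.
move=> /piece_cat_sub[y Ky <-] /piece_cat_sub[z Kz].
rewrite !word_map_cat => /word_map_inj yz.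
by exists (Sw [:: a] y); split; [exists y|exists z].
Qed.

Lemma word_map_open_disjoint (O : set 'rV[R]_d) w v :
  (forall i, S i @` O `<=` O) ->
  (forall i j, i != j -> S i @` O `&` S j @` O = set0) ->
  ~~ prefix w v && ~~ prefix v w -> Sw w @` O `&` Sw v @` O = set0.
Proof.
move=> SO Odisj /andP[/not_prefixP /[apply]] [u [a [b [w' [v' [ab -> ->]]]]]].
rewrite -subset0 => x [[y Oy <-] [z Oz]].
rewrite !word_map_cat => /word_map_inj /= yz.
have : (S a @` O `&` S b @` O) (S a (Sw w' y)).
  split; first by exists (Sw w' y) => //; apply: (word_map_invariant SO); exists y.
  by rewrite -yz; exists (Sw v' z) => //; apply: (word_map_invariant SO); exists z.
by rewrite (Odisj _ _ ab).
Qed.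

(* Every similarity is onto, so the image of [O] under [Sw w] contains the ball of
   radius [c * word_ratio w] around [Sw w x0]. *)
Lemma level_separated : exists (x0 : 'rV[R]_d) (c : R), 0 < c /\
  forall rho w v, rho <= 1 -> level rho w -> level rho v -> w <> v ->
    c * rho <= edist (Sw w x0) (Sw v x0).
Proof.
have [U [openU [x0 Uo] SU Udisj]] := OSC.
have [q [q0 q1 qr]] := exists_pos_lbound r_gt0.
have /nbhs_ballP[c /= c0 cU] : nbhs x0 U by exact: open_nbhs_nbhs.
(* Removing the last letter leaves a ratio above [rho], and a letter costs a factor of at least [q];
   for the empty word [rho <= 1] is used. *)
have level_lb rho w : rho <= 1 -> level rho w -> q * rho <= word_ratio w.
  case/lastP: w => [|w i] rho1 [lw wP].
    by rewrite /word_ratio big_nil mulr_ile1// ltW// (lt_le_trans _ lw)// word_ratio_gt0.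
  have /ltW wrho : rho < word_ratio w.
    apply: wP; first exact: prefix_rcons.
    by apply/eqP => /(congr1 size) /eqP; rewrite size_rcons ltn_eqF.
  rewrite -cats1 word_ratio_cat {2}/word_ratio big_seq1 mulrC ler_pM//.
    by rewrite ltW// (lt_le_trans _ lw)// word_ratio_gt0.
  exact: ltW.
exists x0, (c * q); split=> [|rho w v rho1 lw lv wv]; first exact: mulr_gt0.
rewrite leNgt; apply/negP => close.
(* If the two points were too close, [Sw v x0] would be [Sw w z] with [z] in the ball inside [U],
   and so would lie in both images of [U]. *)
have [z zv] := word_map_surj w (Sw v x0).
have Uz : U z.
  apply: cU; rewrite mx_norm_ball /ball_/=; apply: le_lt_trans (normr_le_edist _ _) _.
  rewrite -(@ltr_pM2l _ (word_ratio w)) ?word_ratio_gt0// -edist_word_map zv.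
  apply: lt_le_trans close _; rewrite -mulrA [leRHS]mulrC ler_pM2l//.
  exact: level_lb.
have := word_map_open_disjoint SU Udisj (level_not_prefix lw lv wv).
by rewrite -subset0 => /(_ (Sw v x0)); apply; split; [exists z|exists x0].
Qed.

Lemma attractor_bound (x0 : 'rV[R]_d) :
  exists D, 0 <= D /\ forall k, K k -> edist x0 k <= D.
Proof.
have [Kcomp _ _] := attrK; have [M [_ MK]] := compact_bounded Kcomp.
exists (d%:R * (`|x0| + (`|M| + 1))); split=> [|k Kk].
  by rewrite mulr_ge0// !addr_ge0.
apply: le_trans (edist_le_normr _ _) _; rewrite ler_wpM2l//.
apply: le_trans (ler_normB _ _) _; rewrite lerD2l.
by apply: MK Kk; rewrite (le_lt_trans (ler_norm M))// ltrDl.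
Qed.

Lemma level_normr (x0 : 'rV[R]_d) (D : R) rho w x :
  (forall k, K k -> edist x0 k <= D) ->
  level rho w -> Kw w x -> `|Sw w x0 - x| <= D * rho.
Proof.
move=> DK [lw _] [k Kk <-]; apply: le_trans (normr_le_edist _ _) _.
by rewrite edist_word_map mulrC ler_pM ?edist_ge0 ?DK// ltW// word_ratio_gt0.
Qed.

Lemma level_coord (x0 : 'rV[R]_d) (D : R) rho w x i :
  (forall k, K k -> edist x0 k <= D) ->
  level rho w -> Kw w x -> `|Sw w x0 0 i - x 0 i| <= D * rho.
Proof.
move=> DK lw wx; apply: le_trans (level_normr DK lw wx).
by apply: le_trans (coord_le_normr _ i); rewrite !mxE.
Qed.

(** The points [Sw w x0] are [c * rho] apart and, in each coordinate, within [2 * D * rho] of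
    [Sw v x0]. *)
Lemma card_level_meeting : exists N, forall rho v, 0 < rho -> rho <= 1 ->
  level rho v ->
  ([set w | level rho w /\ Kw w `&` Kw v !=set0] #<= `I_N)%card.
Proof.
have [x0 [c [c0 osep]]] := level_separated; have [D [_ DK]] := attractor_bound x0.
have [N NP] := card_le_separated (fun w => Sw w x0) (2 * D) c0.
exists N => rho v rho0 rho1 lv; apply: (NP _ rho (Sw v x0)) => //.
  move=> w i [lw [x [wx vx]]].
  have := lerD (level_coord i DK lw wx) (level_coord i DK lv vx).
  rewrite -mulrA [2 * _]mulr_natl mulr2n; apply: le_trans.
  by rewrite [X in _ <= _ + X]distrC (le_trans _ (ler_normD _ _))// addrA subrK.
by move=> w w' [lw _] [lw' _]; exact: osep.
Qed.

Lemma finite_level rho : 0 < rho -> rho <= 1 -> finite_set (level rho).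
Proof.
move=> rho0 rho1.
have [x0 [c [c0 osep]]] := level_separated; have [D [_ DK]] := attractor_bound x0.
(* Multiplied by [rho], this constant is [D * rho + D]: the size of a level piece plus the distance
   from [x0] to [K]. *)
have [N NP] := card_le_separated (fun w => Sw w x0) (D + D / rho) c0.
apply/finite_set_leP; exists N; apply: (NP _ rho x0) => //.
  move=> w i lw; have [_ [k Kk] _] := attrK.
  have wk : Kw w (Sw w k) by exists k.
  have DSk := DK _ (piece_sub wk).
  rewrite mulrDl divfK ?gt_eqF// -(subrK (Sw w k 0 i) (Sw w x0 0 i)) -addrA.
  apply: le_trans (ler_normD _ _) _; rewrite lerD ?(level_coord i DK lw wk)//.
  apply: le_trans DSk; rewrite edistC; apply: le_trans (normr_le_edist _ _).
  by apply: le_trans (coord_le_normr _ i); rewrite !mxE.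
by move=> w w' lw lw'; exact: osep.
Qed.

Lemma card_level_containing : exists N, forall rho x, 0 < rho -> rho <= 1 ->
  ([set w | level rho w /\ Kw w x] #<= `I_N)%card.
Proof.
have [N NP] := card_level_meeting; exists N => rho x rho0 rho1.
have [->|/set0P[v [lv vx]]] := eqVneq [set w | level rho w /\ Kw w x] set0.
  exact: card_ge0.
apply: card_le_trans (NP rho v rho0 rho1 lv); apply: subset_card_le.
by move=> w [lw wx]; split => //; exists x.
Qed.

(** The analogue of [piece_boundary] for words of one level instead of one length. *)
Definition level_frontier rho v :=
  \bigcup_(w in [set w | level rho w /\ w <> v]) (Kw w `&` Kw v).

Lemma card_level_frontier : exists N, forall rho v, 0 < rho -> rho <= 1 ->
  level rho v -> (level_frontier rho v #<= `I_N)%card.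
Proof.
have [N NP] := card_level_meeting; exists (N * s)%N => rho v rho0 rho1 lv.
have NP' : ([set w | [/\ level rho w, w <> v & Kw w `&` Kw v !=set0]] #<= `I_N)%card.
  apply: card_le_trans (NP rho v rho0 rho1 lv); apply: subset_card_le.
  by move=> w [].
apply: card_le_trans (card_bigcup_le NP' (F := fun w => Kw w `&` Kw v) _).
  apply: subset_card_le => x [w [lw wv] [wx vx]]; exists w; last by split.
  by split=> //; exists x.
by move=> w [lw wv _]; apply: card_piece_intersection; exact: level_not_prefix lw lv wv.
Qed.

(* A word [i] of the length of [j] is cut or extended to reach the level of [j];
   the result differs from [j] because it is comparable to [i] for [prefix]. *)
Lemma piece_boundary_sub j :
  piece_boundary S K j `<=` level_frontier (word_ratio j) j.
Proof.
move=> x [i [ij nij] [ix jx]].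
have [w [lw wx wi]] := level_through (word_ratio_gt0 j) ix.
exists w => //; split => // wj; apply: nij; move: wi; rewrite wj !prefixE ij.
by rewrite -[X in take X i]ij !take_size => /orP[] /eqP.
Qed.

Lemma card_piece_boundary : exists N, forall j, (piece_boundary S K j #<= `I_N)%card.
Proof.
have [N NP] := card_level_frontier; exists N => j.
apply: card_le_trans (subset_card_le (@piece_boundary_sub j)) _.
apply: NP; [exact: word_ratio_gt0|exact: word_ratio_le1|exact: level_word_ratio].
Qed.

(** * Topology of pieces and counting of addresses *)

Lemma word_map_continuous w : continuous (Sw w).
Proof.
move=> x U /nbhs_ballP[e /= e0 eU]; apply/nbhs_ballP.
exists (e / d.+1%:R) => /= [|y]; first by rewrite divr_gt0.
rewrite mx_norm_ball /ball_/= => xy; apply: eU; rewrite mx_norm_ball /ball_/=.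
apply: le_lt_trans (normr_le_edist _ _) _; rewrite edist_word_map.
apply: le_lt_trans (_ : d.+1%:R * `|x - y| < e); last by rewrite mulrC -ltr_pdivlMr.
rewrite -[leRHS]mul1r ler_pM ?edist_ge0 ?word_ratio_le1 ?(ltW (word_ratio_gt0 _))//.
by apply: le_trans (edist_le_normr _ _) _; rewrite ler_wpM2r// ler_nat.
Qed.

Lemma piece_compact w : compact (Kw w).
Proof.
have [Kcomp _ _] := attrK; apply: continuous_compact => //.
exact: continuous_subspaceT (@word_map_continuous w).
Qed.

Lemma piece_closed w : closed (Kw w).
Proof. by apply: compact_closed; [exact: norm_hausdorff|exact: piece_compact]. Qed.

(** A cluster point of the images of [k] under the initial words lies in every closed piece of the
    nested sequence, so [xget] does not return its default. *)
Lemma coding_map_piece (alpha : nat -> 'I_m) n : (0 < n)%N ->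
  Kw (mkseq alpha n) (coding_map S K alpha).
Proof.
move=> n0; have [_ [k Kk] _] := attrK.
have Kcomp : compact (Kw [::]) by exact: piece_compact.
pose u n := Sw (mkseq alpha n) k.
have uw l : \forall i \near \oo, Kw (mkseq alpha l) (u i).
  exists l => // i /= li; have : prefix (mkseq alpha l) (mkseq alpha i).
    by rewrite prefixE size_mkseq -map_take take_iota (minn_idPl li).
  by move=> /piece_prefix_sub; apply; exists k.
have [x [_ xclu]] := Kcomp (u @ \oo) _ (uw 0%N).
have xcap : (\bigcap_(l in [set l | (0 < l)%N]) Kw (mkseq alpha l)) x.
  move=> l _; rewrite (closure_id (Kw _)).1; last exact: piece_closed.
  by move=> B xB; apply: xclu; [exact: uw|].
have := @xgetPex _ 0 _ (ex_intro _ x xcap); exact.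
Qed.

(* Distinct addresses of [x] have distinct beginnings of some length [L]; the words
   of a level with ratios below those of all these beginnings extend them. *)
Lemma card_addresses : exists N, forall x,
  (coding_map S K @^-1` [set x] #<= `I_N)%card.
Proof.
have [N NP] := card_level_containing; exists N => x; apply: contrapT.
move=> /not_card_leP[f fx finj].
have /choice[l lP] (ij : 'I_N.+1 * 'I_N.+1) : exists l, ij.1 != ij.2 ->
    f ij.1 l <> f ij.2 l.
  have [eij|nij] := eqVneq ij.1 ij.2; first by exists 0%N.
  have /existsNP[k kP] : ~ forall k, f ij.1 k = f ij.2 k.
    by move=> /funext /finj /eqP; apply/negP.
  by exists k.
(* The successor is needed because a beginning of length [L] shows only positions below [L]. *)
pose L := (\max_ij l ij).+1.
have Linj i j : mkseq (f i) L = mkseq (f j) L -> i = j.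
  move=> eL; apply/eqP; apply: contraT => /(lP (i, j))[].
  have lL : (l (i, j) < L)%N by rewrite ltnS leq_bigmax.
  by have := congr1 (fun z => nth (f i 0%N) z (l (i, j))) eL; rewrite !nth_mkseq.
have [e [e0 e1 eP]] := exists_pos_lbound (fun i => word_ratio_gt0 (mkseq (f i) L)).
(* Every prefix of a beginning has ratio at least [e], so halving [e] prevents a level word from
   being such a prefix. *)
have rho0 : 0 < e / 2 by rewrite divr_gt0.
have /choice[w wP] i : exists w, [/\ level (e / 2) w, Kw w x & prefix (mkseq (f i) L) w].
  have xL : Kw (mkseq (f i) L) x by rewrite -(fx i); exact: coding_map_piece.
  have [w [lw wx /orP[wL|Lw]]] := level_through rho0 xL; last by exists w.
  have : word_ratio (mkseq (f i) L) <= e / 2.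
    by case: lw => lw _; apply: le_trans lw; exact: word_ratio_prefix_le.
  by rewrite leNgt => /negP[]; apply: lt_le_trans (eP i); rewrite ltr_pdivrMr//; lra.
apply: (@card_le_pigeonhole _ _ _ w (NP (e / 2) x rho0 _)); first lra.
  by move=> i; have [] := wP i.
move=> i j wij; apply: Linj.
have [_ _] := wP i; have [_ _] := wP j.
by rewrite !prefixE wij !size_mkseq => /eqP <- /eqP <-.
Qed.

(** * Neighbourhoods with few boundary points *)

(** The ratio bound rules out that [w] is a proper prefix of [j]. If [j] is not a prefix of [w]
    either, cutting [w] to the length of [j], or extending it through a common point, gives another
    word of that length, so the common point is in the boundary. *)
Lemma level_meeting_piece rho j w : rho <= word_ratio j -> level rho w ->
  Kw w `&` Kw j !=set0 ->
  Kw w `<=` Kw j \/ Kw w `&` piece_boundary S K j !=set0.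
Proof.
move=> rhoj [lw wP] [x [wx jx]].
have [/piece_prefix_sub|jw] := boolP (prefix j w); first by left.
right; exists x; split => //.
have wj : ~~ prefix w j.
  apply/negP => wj; have nwj : w != j by apply: contraNneq jw => ->; exact: prefix_refl.
  have := word_ratio_prefix_lt wj nwj; apply/negP; rewrite -leNgt.
  exact: le_trans lw rhoj.
have [jlw|wlj] := leqP (size j) (size w).
  exists (take (size j) w); last first.
    by split=> //; apply: piece_prefix_sub wx; exact: prefix_take.
  by split; [rewrite size_takel|move/eqP; apply/negP; rewrite -prefixE].
have [v vs wvx] := piece_extend (size j - size w) wx.
exists (w ++ v) => //; split; first by rewrite size_cat vs subnKC// ltnW.
by move=> wvj; move: wj; rewrite -wvj prefix_prefix.
Qed.

(* [V] is the complement of the level pieces which do not meet [A], for a small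
   level: its boundary points lie in such a piece and also in one which meets
   [A] without being contained in it. *)
Lemma small_boundary : exists N, forall n (A B : set 'rV[R]_d),
  compact A -> A `<=` K -> (B #<= `I_n)%card ->
  (exists2 rho0, 0 < rho0 & forall rho w, rho <= rho0 -> level rho w ->
     Kw w `&` A !=set0 -> Kw w `<=` A \/ Kw w `&` B !=set0) ->
  forall U : set K, open U -> [set x : K | A (\val x)] `<=` U ->
  exists V : set K, [/\ open V, [set x : K | A (\val x)] `<=` V, V `<=` U &
    (boundary V #<= `I_(n * N))%card].
Proof.
have [N1 N1P] := card_level_containing; have [N2 N2P] := card_level_frontier.
exists (N1 * N2)%N => n A B Acomp AK Bn [rho0 rho0_gt0 AB] U [U' oU' <-] AU.
have [e e0 eU] : exists2 e, 0 < e & forall a x, A a -> `|a - x| < e -> U' x.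
  apply: compact_open_collar => // a Aa.
  by have := AU (exist _ a (mem_set (AK a Aa))) Aa.
have [D [D0 DK]] := attractor_bound 0.
have [rho [rho_gt0 rho1 rhorho0 rhoe]] :
    exists rho, [/\ 0 < rho, rho <= 1, rho <= rho0 & D * rho + D * rho < e].
  have D1 : 0 < 2 * D + 1 by lra.
  (* Adding 1 to [2 * D] keeps the denominator positive when [D = 0] and makes the last inequality
     strict. *)
  exists (Num.min 1 (Num.min rho0 (e / (2 * D + 1)))); split.
  - by rewrite !lt_min ltr01 rho0_gt0 divr_gt0.
  - by rewrite ge_min lexx.
  - by rewrite !ge_min lexx !orbT.
  - set rho := Num.min _ _; have : rho <= e / (2 * D + 1) by rewrite !ge_min lexx !orbT.
    rewrite ler_pdivlMr// => rhoe.
    have : 0 < rho by rewrite !lt_min ltr01 rho0_gt0 divr_gt0.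
    lra.
have diam w x y : level rho w -> Kw w x -> Kw w y -> `|x - y| < e.
  move=> lw wx wy; apply: le_lt_trans rhoe; rewrite -(subrK (Sw w 0) x) -addrA.
  apply: le_trans (ler_normD _ _) _; rewrite distrC.
  by rewrite lerD// (level_normr DK lw).
pose away := [set w | level rho w /\ Kw w `&` A = set0].
pose meeting := [set w | level rho w /\ Kw w `&` A !=set0].
have closed_union (W : set (seq 'I_m)) : W `<=` level rho -> closed (\bigcup_(w in W) Kw w).
  move=> Wl; apply: closed_bigcup => [|w _]; last exact: piece_closed.
  exact: sub_finite_set Wl (finite_level rho_gt0 rho1).
have val_continuous : continuous (\val : K -> 'rV[R]_d) by exact: initial_continuous.
pose V : set K := \val @^-1` (~` \bigcup_(w in away) Kw w).
have oV : open V.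
  by apply: open_comp => [//|]; apply: closed_openC; apply: closed_union => w [].
have cover (x : K) : exists2 w, level rho w & Kw w (\val x).
  have Kx : Kw [::] (\val x) by exists (\val x) => //; exact: set_valP.
  by have [w [lw wx _]] := level_through rho_gt0 Kx; exists w.
have VU (x : K) : V x -> (\bigcup_(w in meeting) Kw w) (\val x).
  move=> Vx; have [w lw wx] := cover x; exists w => //; split => //.
  by apply/set0P/eqP => wA; apply: Vx; exists w.
exists V; split=> //.
- by move=> x Ax [w [_ wA] wx]; move: wA; apply/eqP/set0P; exists (\val x).
- move=> x /VU[w [lw [a [wa Aa]]] wx]; apply: (eU a) => //; exact: (diam w).
- apply: (card_le_image_inj (f := \val)) => [|]; first exact: val_inj.
  pose hitting := [set w | level rho w /\ Kw w `&` B !=set0].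
  have hitting_card : (hitting #<= `I_(n * N1))%card.
    apply: card_le_trans (card_bigcup_le Bn
      (fun b _ => N1P rho b rho_gt0 rho1)).
    by apply: subset_card_le => w [lw [b [wb Bb]]]; exists b.
  rewrite mulnA; apply: card_le_trans (card_bigcup_le hitting_card
    (F := level_frontier rho) _); last by move=> w [lw _]; exact: N2P.
  apply: subset_card_le => _ [x [clVx nVx] <-].
  have [w' [lw' w'A] w'x] : (\bigcup_(w in away) Kw w) (\val x).
    by apply: contrapT => nx; apply: nVx; apply: open_nbhs_nbhs.
  (* A boundary point is a limit of [V], hence in the union of the meeting pieces, which is closed
     because the level is finite. *)
  have [w [lw wA] wx] : (\bigcup_(w in meeting) Kw w) (\val x).
    pose Q : set K := \val @^-1` (\bigcup_(w in meeting) Kw w).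
    have clQ : closed Q by apply: closed_comp => //; apply: closed_union => w [].
    by have := closureS (VU : V `<=` Q) clVx; rewrite -((closure_id Q).1 clQ).
  have disj y : Kw w' y -> ~ A y.
    by move=> w'y Ay; move: w'A; apply/eqP/set0P; exists y.
  exists w; last first.
    exists w' => //; split => // ww'; have [a [wa Aa]] := wA.
    by apply: (disj a) => //; rewrite ww'.
  (* [Kw w] cannot lie inside [A], since it shares [x] with [Kw w'], which is disjoint from [A]; so
     it meets [B]. *)
  split => //; have [wsubA|//] := AB rho w rhorho0 lw wA.
  by case: (disj _ w'x); exact: wsubA.
Qed.

End IteratedFunctionSystem.

(** * The six uniform bounds *)

Theorem theorem3p1 (R : realType) (d m s : nat)
    (S : 'I_m -> 'rV[R]_d -> 'rV[R]_d) (K : set 'rV[R]_d)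
    (hS : forall i : 'I_m, contracting_similarity (S i))
    (hK : is_attractor S K)
    (hFI : FI_system s S K)
    (hOSC : open_set_condition S) :
  (exists M : nat, forall x : K,
     (counting (coding_map S K @^-1` [set \val x]) <= M%:R%:E :> \bar R)%E) /\
  (exists M : nat, forall j : seq 'I_m, j <> [::] ->
     (counting (coding_map S K @^-1` piece_boundary S K j)
        <= M%:R%:E :> \bar R)%E) /\
  (exists M : nat, forall x : K,
     (component_number R [set x] <= M%:R%:E)%E) /\
  (exists M : nat, forall j : seq 'I_m, j <> [::] ->
     (component_number R (piece_in S K j) <= M%:R%:E)%E) /\
  (exists M : nat, forall x : K,
     (menger_order R [set x] <= M%:R%:E)%E) /\
  (exists M : nat, forall j : seq 'I_m, j <> [::] ->
     (menger_order R (piece_in S K j) <= M%:R%:E)%E).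
Proof.
have /choice[r rP] := hS.
have r0 i : 0 < r i by have [] := rP i.
have r1 i : r i < 1 by have [] := rP i.
have Sr i : forall x y, edist (S i x) (S i y) = r i * edist x y by have [] := rP i.
have [Na NaP] := card_addresses r0 r1 Sr hK hOSC.
have [Nb NbP] := card_piece_boundary r0 r1 Sr hK hFI hOSC.
have [N NP] := small_boundary r0 r1 Sr hK hFI hOSC.
have T1K : accessible_space K.
  move=> x y xy.
  have [|U [oU xU yU]] :=
      hausdorff_accessible (@norm_hausdorff _ 'rV[R]_d) (x := \val x) (y := \val y).
    by rewrite (inj_eq val_inj).
  exists (\val @^-1` U); split; [by exists U|by rewrite inE/=; exact: set_mem|].
  by rewrite inE/=; exact: (set_mem yU).
have pt (x : K) U : open U -> [set x] `<=` U ->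
    exists V, [/\ open V, [set x] `<=` V, V `<=` U & (boundary V #<= `I_(1 * N))%card].
  have <- : [set y : K | [set \val x] (\val y)] = [set x].
    by apply/seteqP; split=> y /= => [/val_inj|->].
  apply: (NP 1%N [set \val x] [set \val x]).
  - exact: compact_set1.
  - by move=> _ ->; exact: set_valP.
  - by rewrite (card_le_eql card_set1).
  (* A piece that meets a singleton contains its point, so any threshold works. *)
  - by exists 1 => // rho w _ _; right.
have pc j U : open U -> piece_in S K j `<=` U ->
    exists V, [/\ open V, piece_in S K j `<=` V, V `<=` U &
      (boundary V #<= `I_(Nb * N))%card].
  apply: (NP Nb (piece S K j) (piece_boundary S K j)) => //.
  - exact: (piece_compact r0 r1 Sr hK).
  - exact: (piece_sub hK).
  (* The threshold depends on [j], but the bound on the number of boundary points does not. *)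
  - exists (word_ratio r j); first exact: word_ratio_gt0.
    by move=> rho w; exact: (level_meeting_piece r0 r1 hK).
have j0 j : piece_in S K j !=set0.
  have [_ [k Kk] _] := hK; have jk : piece S K j (word_map S j k) by exists k.
  by exists (SigSub (mem_set (piece_sub hK jk))).
have order_le (A : set K) n : (forall U, open U -> A `<=` U -> exists V,
    [/\ open V, A `<=` V, V `<=` U & (boundary V #<= `I_n)%card]) ->
    (menger_order R A <= n%:R%:E)%E.
  by move=> An; apply: ereal_inf_lbound; exists n.
split; [|split; [|split; [|split; [|split]]]].
- by exists Na => x; exact: counting_le.
- exists (Nb * Na)%N => j _; apply: counting_le.
  apply: card_le_trans (card_bigcup_le (NbP j) (fun x _ => NaP x)).
  by apply: subset_card_le => a ja; exists (coding_map S K a).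
- exists (1 * N)%N => x; apply: component_number_le => //; last exact: pt.
  by exists x.
- by exists (Nb * N)%N => j _; apply: component_number_le => //; exact: pc.
- by exists (1 * N)%N => x; apply: order_le; exact: pt.
- by exists (Nb * N)%N => j _; apply: order_le; exact: pc.
Qed.
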